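(* Let $e=\min\{i\ge 2 : \ell \mid \frac{q^i-1}{q-1}\}$, $d=\nu_\ell\big(\frac{q^e-1}{q-1}\big)$, and let $\vartheta(P)=\nu_\ell([G:P])$ for $P\in\mathcal P$. (a) Suppose $d\le\ell$. Then $\vartheta$ is injective on $\mathcal P^*$ if and only if $\lfloor n/e\rfloor\le d\ell$. (b) Suppose $d=\ell+1$. Then $\vartheta$ is injective on $\mathcal P^*$ if and only if $\lfloor n/e\rfloor\le\ell^2$. (c) Suppose $d>\ell+1$. Then $\vartheta$ is injective on $\mathcal P^*$ if and only if $\lfloor n/e\rfloor<\ell^2+\ell$.
   Context: Let $n\ge 2$, let $G=\mathrm{GL}_n(q)$ be the general linear group over the finite field $F_q$ of characteristic $p$, and let $\ell\ne p$ be a prime. $\nu_\ell$ denotes the $\ell$-adic valuation of integers. $B$ is the group of upper triangular matrices in $G$, and $\mathcal P$ is the set of standard parabolic subgroups (subgroups of $G$ containing $B$). A composition $(a_1,\dots,a_k)$ of $n$ is identified with the block upper triangular subgroup of $G$ with diagonal blocks of sizes $a_1,\dots,a_k$; this gives a bijection between compositions of $n$ and $\mathcal P$. $\mathcal P^*$ is the set of $P\in\mathcal P$ whose composition is nondecreasing with every part equal to $1$ or of the form $e\ell^i$, $i\ge 0$ (so $\mathcal P^*$ corresponds to partitions of $n$ with such parts). *)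

(* Defs.v *)
From HB Require Import structures.
From mathcomp Require Import all_boot all_order all_algebra all_fingroup.

Set Implicit Arguments.
Unset Strict Implicit.
Unset Printing Implicit Defensive.

Import GRing.Theory.
Local Open Scope nat_scope.

(* Elements of {'GL_n[F]} are invertible matrices of size n.-1.+1, which is n  *)
(* as soon as 0 < n.                                                           *)

Section Parabolic.

Variables (n : nat) (F : finFieldType).

Definition borel : {set {'GL_n[F]}} :=
  [set g | [forall i : 'I_n.-1.+1, forall j : 'I_n.-1.+1,
     (j < i) ==> (GLval g i j == 0%R)]].

Definition standard_parabolics : {set {group {'GL_n[F]}}} :=
  [set P : {group {'GL_n[F]}} | borel \subset P].

Definition is_composition (a : seq nat) : bool :=
  (sumn a == n) && all (leq 1) a.

(* reshape_index a i is the number of the block of a containing the index i.   *)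
Definition block_upper (a : seq nat) : {set {'GL_n[F]}} :=
  [set g | [forall i : 'I_n.-1.+1, forall j : 'I_n.-1.+1,
     (reshape_index a j < reshape_index a i) ==> (GLval g i j == 0%R)]].

Lemma block_upper_group_set a : group_set (block_upper a).
Proof.
apply/group_setP; split=> [|g h].
  rewrite inE; apply/forallP=> i; apply/forallP=> j; apply/implyP=> ltji.
  rewrite GL_1E mxE; have [eq_ij|_] := eqVneq i j; last by rewrite mulr0n.
  by rewrite eq_ij ltnn in ltji.
rewrite !inE => /forallP gP /forallP hP.
apply/forallP=> i; apply/forallP=> j; apply/implyP=> ltji.
rewrite GL_ME mxE big1 // => k _.
have [lt_ki | le_ik] := ltnP (reshape_index a k) (reshape_index a i).
  by have /forallP/(_ k)/implyP/(_ lt_ki)/eqP-> := gP i; rewrite mul0r.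
have lt_jk := leq_trans ltji le_ik.
by have /forallP/(_ j)/implyP/(_ lt_jk)/eqP-> := hP k; rewrite mulr0.
Qed.

Canonical block_upper_group a := Group (block_upper_group_set a).

Definition in_Pstar (e l : nat) (P : {group {'GL_n[F]}}) : Prop :=
  P \in standard_parabolics /\
  exists a : seq nat,
    [/\ is_composition a, P = block_upper_group a, sorted leq a
      & forall x, x \in a -> x = 1 \/ exists i, x = e * l ^ i].

Definition theta (l : nat) (P : {group {'GL_n[F]}}) : nat :=
  logn l #|'GL_n[F] : P|%g.

Definition theta_injective (e l : nat) : Prop :=
  forall P Q : {group {'GL_n[F]}},
    in_Pstar e l P -> in_Pstar e l Q -> theta l P = theta l Q -> P = Q.

End Parabolic.

(* The division is exact when 1 < q.                                          *)
Definition geom_quot (q i : nat) : nat := (q ^ i - 1) %/ (q - 1).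

Definition is_min_index (q l e : nat) : Prop :=
  [/\ 2 <= e, l %| geom_quot q e
    & forall i, 2 <= i -> l %| geom_quot q i -> e <= i].

(* Main.v *)
Require Import Defs.
From mathcomp Require Import all_boot all_order all_algebra all_fingroup.
From mathcomp Require Import zify.

(** Write [i] for (q ^ i - 1) / (q - 1) and v for the l-adic valuation. The
    Levi decomposition writes the order of the parabolic subgroup P_a attached
    to a composition a of n as a power of q times the product of the orders of
    GL_x for x in a. As l does not divide q, the valuation of that order is
    n v(q - 1) plus the sum over x in a of v([1] [2] ... [x]). Now l divides
    [i] exactly when e divides i, and v([e k]) = d + v(k) by lifting the
    exponent, so that v([1] ... [x]) = d M + v(M!) with M the integer part of
    x / e (sum_logn_qint). For x = 1 this is 0, and for x = e, e l and e l ^ 2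
    it is d, d l + 1 and d l ^ 2 + l + 1.

    Put N = n / e, rounded down. Below N = l ^ 3 the parts of a composition in
    Pstar can only be 1, e, e l and e l ^ 2, and such a composition is known
    from the multiplicities (m0, m1, m2) of the last three parts, the only
    constraint being m0 + l m1 + l ^ 2 m2 <= N (pstar_partsP). Distinct
    compositions give distinct subgroups (block_upper_inj), and the valuation
    of the index determines and is determined by the weight
    d (m0 + l m1 + l ^ 2 m2) + (m1 + (l + 1) m2). So the theorem says for which
    N this weight is injective on triples of size at most N
    (pweight_injective_iff).

    When the second summand of the weight stays below d, Euclidean division by
    d recovers the triple. Injectivity is lost at the first of these
    collisions that fits in size N:
    (d l + 1, 0, 0) with (0, d, 0), available as soon as N > d l;
    (l ^ 2 + 1, 0, 0) with (0, 0, 1) when d = l + 1, as soon as N > l ^ 2;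
    (l, 0, 1) with (0, l + 1, 0), as soon as N >= l ^ 2 + l. *)

Set Implicit Arguments.
Unset Strict Implicit.
Unset Printing Implicit Defensive.

(** * The weight of a triple of multiplicities *)

(** The triple (m0, m1, m2) stands for m0 parts e, m1 parts e l and m2 parts
    e l ^ 2; the size is the sum of these parts divided by e. *)
Definition psize (l m0 m1 m2 : nat) : nat := m0 + l * m1 + l ^ 2 * m2.

(** The valuation of the order of the parabolic, up to a constant: the second
    summand collects the valuations 0, 1 and l + 1 of 1!, l! and (l ^ 2)!. *)
Definition pweight (l d m0 m1 m2 : nat) : nat :=
  d * psize l m0 m1 m2 + (m1 + l.+1 * m2).

Definition pweight_injective (l d N : nat) : Prop :=
  forall m0 m1 m2 k0 k1 k2,
    psize l m0 m1 m2 <= N -> psize l k0 k1 k2 <= N ->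
    pweight l d m0 m1 m2 = pweight l d k0 k1 k2 ->
    [/\ m0 = k0, m1 = k1 & m2 = k2].

Lemma eq_euclid (b u v u' v' : nat) : v < b -> v' < b ->
  b * u + v = b * u' + v' -> u = u' /\ v = v'.
Proof.
move=> ltvb ltv'b; rewrite !(mulnC b) => eq_uv.
have b_gt0 : 0 < b by apply: leq_ltn_trans ltvb.
split.
  by have /(congr1 (divn^~ b)) := eq_uv; rewrite !divnMDl // !divn_small ?addn0.
by have /(congr1 (modn^~ b)) := eq_uv; rewrite !modnMDl !modn_small.
Qed.

(** Two Euclidean divisions recover the triple from its weight: by d to
    separate the size from m1 + (l + 1) m2, then by l + 1 to separate m1
    from m2. *)
Lemma eq_pweight (l d m0 m1 m2 k0 k1 k2 : nat) :
  m1 <= l -> k1 <= l -> m1 + l.+1 * m2 < d -> k1 + l.+1 * k2 < d ->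
  pweight l d m0 m1 m2 = pweight l d k0 k1 k2 ->
  [/\ m0 = k0, m1 = k1 & m2 = k2].
Proof.
move=> m1l k1l tm tk /(eq_euclid tm tk)[eqS].
rewrite addnC [k1 + _]addnC => /(@eq_euclid l.+1 _ _ _ _ m1l k1l)[eq2 eq1].
by move: eqS; rewrite /psize eq1 eq2 => /addIn/addIn.
Qed.

(** A part e l ^ 2 exhausts a size bounded by l ^ 2, so (0, 0, 1) is the only
    triple up to that bound that uses it. *)
Lemma psize_le_sqr (l m0 m1 m2 : nat) : 1 < l -> psize l m0 m1 m2 <= l ^ 2 ->
  m2 = 0 /\ m1 <= l \/ [/\ m0 = 0, m1 = 0 & m2 = 1].
Proof.
rewrite /psize; set b := l ^ 2 => l_gt1 le_b.
have b_gt0 : 0 < b by rewrite expn_gt0 (ltnW l_gt1).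
case: m2 le_b => [|[|m2]] le_b.
- left; split=> //; rewrite -(leq_pmul2l (ltnW l_gt1)) mulnn.
  by apply: leq_trans le_b; lia.
- by right; split=> //; nia.
- by nia.
Qed.

(** At size d l the remainder m1 may reach d, where division by d breaks down,
    but only for (0, d, 0), whose weight exceeds those of the triples with
    m1 < d. The triple (0, 0, 1) fits only when d = l and is then heavier
    still. *)
Lemma pweight_injective_small (l d : nat) : 1 < l -> 0 < d -> d <= l ->
  pweight_injective l d (d * l).
Proof.
move=> l_gt1 d_gt0 led m0 m1 m2 k0 k1 k2 hm hk.
have le_sq : d * l <= l ^ 2 by rewrite -mulnn leq_mul2r led orbT.
have [[m2_0 m1l]|[m0_0 m1_0 m2_1]] := psize_le_sqr l_gt1 (leq_trans hm le_sq);
have [[k2_0 k1l]|[k0_0 k1_0 k2_1]] := psize_le_sqr l_gt1 (leq_trans hk le_sq);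
  subst; last by [].
- have top x0 x1 : psize l x0 x1 0 <= d * l -> d <= x1 -> x0 = 0 /\ x1 = d.
    by rewrite /psize; nia.
  have below x0 x1 : psize l x0 x1 0 <= d * l -> x1 < d ->
      pweight l d x0 x1 0 < pweight l d 0 d 0.
    rewrite /pweight => hx ltx; rewrite !muln0 !addn0 -addnS.
    apply: leq_add => //; rewrite leq_mul2l (leq_trans hx) ?orbT //.
    by rewrite /psize; lia.
  have [m1ltd|lem1] := ltnP m1 d; have [k1ltd|lek1] := ltnP k1 d.
  + by apply: eq_pweight; rewrite ?muln0 ?addn0.
  + case: (top _ _ hk lek1) => -> -> eqw.
    by have := below _ _ hm m1ltd; rewrite eqw ltnn.
  + case: (top _ _ hm lem1) => -> -> eqw.
    by have := below _ _ hk k1ltd; rewrite -eqw ltnn.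
  + by case: (top _ _ hm lem1) => -> ->; case: (top _ _ hk lek1) => -> ->.
- have d_l : d = l by move: hk; rewrite /psize; nia.
  by subst d; move: hm (leq_mul (leqnn l) hm); rewrite /pweight /psize; nia.
- have d_l : d = l by move: hm; rewrite /psize; nia.
  by subst d; move: hk (leq_mul (leqnn l) hk); rewrite /pweight /psize; nia.
Qed.

(** The remainder m1 + (l + 1) m2 is below d = l + 1 except for (0, 0, 1), and
    that triple is heavier than all others of size at most l ^ 2. *)
Lemma pweight_injective_mid (l : nat) : 1 < l ->
  pweight_injective l l.+1 (l ^ 2).
Proof.
move=> l_gt1 m0 m1 m2 k0 k1 k2 hm hk.
have [[m2_0 m1l]|[m0_0 m1_0 m2_1]] := psize_le_sqr l_gt1 hm;
have [[k2_0 k1l]|[k0_0 k1_0 k2_1]] := psize_le_sqr l_gt1 hk;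
  subst; last by [].
- by apply: eq_pweight; rewrite ?muln0 ?addn0.
- by move: hm hk; rewrite /pweight /psize; nia.
- by move: hm hk; rewrite /pweight /psize; nia.
Qed.

(** The bound on N forces m1 <= l, and m1 = 0 as soon as m2 = 1, so that the
    remainder m1 + (l + 1) m2 is at most l + 1 < d. *)
Lemma pweight_injective_large (l d N : nat) : 1 < l -> l.+1 < d ->
  N < l ^ 2 + l -> pweight_injective l d N.
Proof.
move=> l_gt1 ltd ltN.
have bound m0 m1 m2 : psize l m0 m1 m2 <= N ->
    m1 <= l /\ m1 + l.+1 * m2 < d.
  move/leq_ltn_trans/(_ ltN); rewrite /psize -mulnn => hm.
  have m1l : m1 <= l by nia.
  split=> //; case: m2 hm => [|[|m2]] hm; [by lia | | by nia].
  by case: m1 m1l hm => [|m1] m1l hm; [lia|nia].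
move=> m0 m1 m2 k0 k1 k2 /bound[m1l tm] /bound[k1l tk].
exact: eq_pweight.
Qed.

Lemma pweight_injective_leq (l d N N' : nat) :
  N' <= N -> pweight_injective l d N -> pweight_injective l d N'.
Proof.
move=> leN inj m0 m1 m2 k0 k1 k2 hm hk.
by apply: inj; [apply: leq_trans hm leN | apply: leq_trans hk leN].
Qed.

Lemma pweight_injective_iff (l d N : nat) : 1 < l -> 0 < d ->
  [/\ d <= l -> (pweight_injective l d N <-> N <= d * l),
      d = l.+1 -> (pweight_injective l d N <-> N <= l ^ 2)
    & l.+1 < d -> (pweight_injective l d N <-> N < l ^ 2 + l)].
Proof.
move=> l_gt1 d_gt0; split=> hd; split.
- move=> inj; rewrite leqNgt; apply/negP=> ltN.
  by case: (inj (d * l).+1 0 0 0 d 0); rewrite /pweight /psize; lia.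
- by move/pweight_injective_leq; apply; apply: pweight_injective_small.
- move=> inj; rewrite leqNgt; apply/negP=> ltN.
  by case: (inj (l ^ 2).+1 0 0 0 0 1); rewrite /pweight /psize; lia.
- move/pweight_injective_leq; apply; rewrite hd.
  exact: pweight_injective_mid.
- move=> inj; rewrite ltnNge; apply/negP=> leN.
  by case: (inj l 0 1 0 l.+1 0); rewrite /pweight /psize -?mulnn //; nia.
- exact: pweight_injective_large.
Qed.

(** * Valuations of q-integers *)

Definition qint (q i : nat) : nat := \sum_(j < i) q ^ j.

Lemma geom_quotE (q i : nat) : 1 < q -> geom_quot q i = qint q i.
Proof.
move=> q_gt1; rewrite /geom_quot !subn1 predn_exp mulKn //.
by rewrite -subn1 subn_gt0.
Qed.

(** This is what makes the set of i such that l divides [i] closed under sums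
    and differences, once l is prime to q. *)
Lemma qintD (q i j : nat) : qint q (i + j) = qint q i + q ^ i * qint q j.
Proof.
rewrite /qint big_split_ord /= big_distrr /=; congr (_ + _).
by apply: eq_bigr => k _; rewrite expnD.
Qed.

Lemma qint1 (q : nat) : qint q 1 = 1.
Proof. by rewrite /qint big_ord1. Qed.

Lemma qintM (q i k : nat) : qint q (i * k) = qint q i * qint (q ^ i) k.
Proof.
elim: k => [|k IHk]; first by rewrite muln0 /qint !big_ord0 muln0.
rewrite mulnSr qintD IHk -addn1 qintD qint1 muln1 -expnM mulnDr.
by rewrite [_ * qint q i]mulnC.
Qed.

Lemma qint_gt0 (q i : nat) : 0 < i -> 0 < qint q i.
Proof. by case: i => // i _; rewrite /qint big_ord_recl. Qed.

Lemma qint_mod1 (m q k : nat) : q = 1 %[mod m] -> qint q k = k %[mod m].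
Proof.
move=> q1; rewrite /qint -modn_summ.
under eq_bigr => j _ do rewrite -modnXm q1 modnXm exp1n.
by rewrite modn_summ sum_nat_const card_ord muln1.
Qed.

(** With Q = 1 + l t, the binomial expansion gives Q ^ j = 1 + l t j modulo
    l ^ 2, so the sum of the Q ^ j for j < l is l + l t (l (l - 1) / 2) modulo
    l ^ 2. For odd l the second term vanishes, as l divides l (l - 1) / 2; for
    l = 2 the sum is 1 + Q, whence the condition modulo 4. *)
Lemma logn_qint_prime (l Q : nat) : prime l ->
  Q = 1 %[mod l] -> (l = 2 -> Q = 1 %[mod 4]) -> logn l (qint Q l) = 1.
Proof.
move=> l_pr Q1 Q4; have l_gt1 := prime_gt1 l_pr; have l_gt0 := ltnW l_gt1.
suff modl2 : qint Q l = l %[mod l ^ 2].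
  have dvdl : l %| qint Q l.
    have := qint_mod1 l Q1; rewrite modnn => /eqP. exact.
  have: ~~ (l ^ 2 %| qint Q l).
    by rewrite /dvdn modl2 -/(dvdn _ _) -{2}[l]expn1 dvdn_Pexp2l.
  have q0 := qint_gt0 Q l_gt0.
  rewrite pfactor_dvdn // -ltnNge ltnS => le1; apply/eqP.
  by rewrite eqn_leq le1 -pfactor_dvdn.
have [l2|l_odd] := even_prime l_pr.
  by subst l; apply: qint_mod1; apply: Q4.
have l2 : 2 < l by case: (l) l_gt1 l_odd => [|[|[]]].
set t := Q %/ l; have Qt : Q = t * l + 1.
  by rewrite {1}(divn_eq Q l) Q1 modn_small.
have powQ j : Q ^ j = 1 + l * t * j %[mod l ^ 2].
  elim: j => [|j IHj]; first by rewrite muln0.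
  rewrite expnS -modnMmr IHj modnMmr {1}Qt.
  have -> : (t * l + 1) * (1 + l * t * j) =
            (t ^ 2 * j) * l ^ 2 + (1 + l * t * j.+1).
    by rewrite -!mulnn; lia.
  by rewrite modnMDl.
rewrite /qint -modn_summ; under eq_bigr => j _ do rewrite powQ.
rewrite modn_summ big_split /= sum_nat_const card_ord muln1 -big_distrr /=.
rewrite -(big_mkord xpredT id) bin2_sum.
have /dvdnP[c ->] : l %| 'C(l, 2) by apply: prime_dvd_bin.
have -> : l + l * t * (c * l) = t * c * l ^ 2 + l by rewrite -mulnn; lia.
by rewrite modnMDl.
Qed.

(** Lifting the exponent: strip the factors l of k one at a time with
    [l c]_Q = [l]_Q [c]_(Q ^ l), until k is prime to l, where [k]_Q = k
    modulo l is a unit. *)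
Lemma logn_qint (l Q k : nat) : prime l ->
  Q = 1 %[mod l] -> (l = 2 -> Q = 1 %[mod 4]) -> 0 < k ->
  logn l (qint Q k) = logn l k.
Proof.
move=> l_pr; have [l_gt1 l_gt0] := (prime_gt1 l_pr, prime_gt0 l_pr).
elim/ltn_ind: k Q => k IHk Q Q1 Q4 k_gt0.
have [/dvdnP[c def_k]|ndvd] := boolP (l %| k); last first.
  rewrite !logn_coprime // prime_coprime //.
  by rewrite /dvdn qint_mod1.
have c_gt0 : 0 < c by move: k_gt0; rewrite def_k muln_gt0 => /andP[].
rewrite def_k mulnC qintM !lognM ?qint_gt0 // logn_qint_prime //.
rewrite IHk //; first by rewrite (@logn_prime l l) // eqxx.
- by rewrite def_k -[X in X < _]muln1 ltn_pmul2l.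
- by rewrite -modnXm Q1 modnXm exp1n.
- by move/Q4 => Q4'; rewrite -modnXm Q4' modnXm exp1n.
Qed.

Section MinIndex.
Variables (q l e : nat).
Hypotheses (q_gt1 : 1 < q) (l_pr : prime l) (he : is_min_index q l e).

Lemma min_index_dvd_qint : l %| qint q e.
Proof. by case: he => _; rewrite geom_quotE. Qed.

(** If l divided q, then [e] would be congruent to 1 modulo l. *)
Lemma min_index_coprime : coprime l q.
Proof.
case: he => e2 _ _; rewrite prime_coprime //; apply/negP=> lq.
have := min_index_dvd_qint; rewrite -(subnKC (ltnW e2)) qintD qint1 expn1.
by rewrite dvdn_addl ?dvdn_mulr // dvdn1 => /eqP l1; have := l_pr; rewrite l1.
Qed.

(** Write i = e k + r with r < e: since l divides [e k], it divides [i] iff it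
    divides [r]. The minimality of e excludes 2 <= r, and [1] = 1. This covers
    at once the case where e is the order of q modulo l and the case e = l
    where l divides q - 1. *)
Lemma dvdn_qint (i : nat) : (l %| qint q i) = (e %| i).
Proof.
case: he => e2 _ emin.
have dvd_mul k : l %| qint q (e * k).
  by rewrite qintM dvdn_mulr ?min_index_dvd_qint.
apply/idP/idP=> [|/dvdnP[k ->]]; last by rewrite mulnC.
rewrite {1}(divn_eq i e) mulnC qintD dvdn_addr // Gauss_dvdr; last first.
  by rewrite coprimeXr ?min_index_coprime.
have := ltn_pmod i (ltnW e2); rewrite /dvdn; set r := i %% e => ltr.
case: (posnP r) => [-> //|r_gt0].
case: (ltngtP r 1) => [|r_gt1|->]; first by rewrite ltnNge r_gt0.
  by have := emin r r_gt1; rewrite geom_quotE // leqNgt ltr => /[apply].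
by rewrite qint1 modn_small ?prime_gt1.
Qed.

(** For l = 2 the index e is 2, so that q ^ e is an odd square and the
    hypothesis modulo 4 in the lifting lemma holds. *)
Lemma logn_qint_mul (k : nat) : 0 < k ->
  logn l (qint q (e * k)) = logn l (qint q e) + logn l k.
Proof.
case: (he) => e2 _ emin k_gt0.
have e_gt0 := ltnW e2.
rewrite qintM lognM ?qint_gt0 // (@logn_qint l (q ^ e)) //.
  apply/eqP; rewrite eqn_mod_dvd ?expn_gt0 ?(ltnW q_gt1) //.
  by rewrite subn1 predn_exp dvdn_mull // min_index_dvd_qint.
move=> l2; have q_odd : odd q.
  by have := min_index_coprime; rewrite l2 coprime2n.
have e_2 : e = 2.
  apply/eqP; rewrite eqn_leq e2 andbT emin // geom_quotE // l2.
  by rewrite /qint !big_ord_recl big_ord0 dvdn2 addn0 expn0 expn1 /= q_odd.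
rewrite e_2 -modnXm.
have : odd (q %% 4) by rewrite (@odd_mod q 4).
by have := ltn_pmod q (isT : 0 < 4); case: (q %% 4) => [|[|[|[|]]]].
Qed.
End MinIndex.

Lemma sum_supported_multiples (e : nat) (g h : nat -> nat) (m : nat) :
  0 < e -> (forall i, ~~ (e %| i) -> g i = 0) ->
  (forall k, 0 < k -> g (e * k) = h k) ->
  \sum_(1 <= i < m.+1) g i = \sum_(1 <= k < (m %/ e).+1) h k.
Proof.
move=> e_gt0 g0 gh; elim: m => [|m IHm]; first by rewrite div0n !big_geq.
rewrite big_nat_recr //= IHm divnS //.
have [/dvdnP[k def_m]|ndvd] := boolP (e %| m.+1); last by rewrite g0 ?addn0.
rewrite add1n [RHS]big_nat_recr //=; congr (_ + _).
rewrite def_m mulnC gh; first congr h; last first.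
  by case: k def_m.
have : m.+1 %/ e = (m %/ e).+1 by rewrite divnS // def_m dvdn_mull.
by rewrite def_m mulnK.
Qed.

Lemma logn_fact_sum (l m : nat) : logn l m`! = \sum_(1 <= i < m.+1) logn l i.
Proof.
elim: m => [|m IHm]; first by rewrite big_geq // fact0 logn1.
by rewrite big_nat_recr //= -IHm factS lognM ?fact_gt0 // addnC.
Qed.

(** Among 1, ..., l m the prime l divides only the l k with k <= m, and each of
    these contributes 1 + v(k). *)
Lemma logn_fact_mul (l m : nat) : prime l -> logn l (l * m)`! = m + logn l m`!.
Proof.
move=> l_pr; have l_gt0 := prime_gt0 l_pr.
rewrite !logn_fact_sum.
rewrite (@sum_supported_multiples l (logn l) (fun k => 1 + logn l k)).
- by rewrite mulKn // big_split /= sum_nat_const_nat muln1 subn1.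
- exact: l_gt0.
- by move=> i ndvd; rewrite logn_coprime // prime_coprime.
- by move=> k k_gt0; rewrite lognM // logn_prime // eqxx.
Qed.

(** The valuation of the q-factorial of m: the i divisible by e carry all of
    it, and [e k] contributes d + v(k). *)
Lemma sum_logn_qint (q l e m : nat) : 1 < q -> prime l -> is_min_index q l e ->
  \sum_(1 <= i < m.+1) logn l (qint q i) =
    logn l (geom_quot q e) * (m %/ e) + logn l (m %/ e)`!.
Proof.
move=> q_gt1 l_pr he; have e_gt0 : 0 < e by case: he => /ltnW.
rewrite (@sum_supported_multiples e _
  (fun k => logn l (geom_quot q e) + logn l k)) //.
- by rewrite big_split /= sum_nat_const_nat subn1 -logn_fact_sum mulnC.
- by move=> i ndvd; rewrite logn_coprime // prime_coprime // (@dvdn_qint q l e).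
- by move=> k k_gt0; rewrite (@logn_qint_mul q l e) // geom_quotE.
Qed.

(** * Block numbers of a composition *)

Lemma reshape_index_cons (x : nat) (s : seq nat) (i : nat) :
  reshape_index (x :: s) i = if i < x then 0 else (reshape_index s (i - x)).+1.
Proof.
rewrite /reshape_index /= -/(leq i.+1 x).
by have [//|lexi] := ltnP i x; rewrite subSn.
Qed.

Lemma leq_reshape_index (s : seq nat) (i j : nat) :
  i <= j -> reshape_index s i <= reshape_index s j.
Proof.
elim: s i j => [|x s IHs] i j le_ij; first by [].
rewrite !reshape_index_cons; have [//|lexi] := ltnP i x.
by rewrite [j < x]ltnNge (leq_trans lexi le_ij) ltnS IHs ?leq_sub2r.
Qed.

(** The order relation between block numbers tells where the first block ends:
    the index x is the first one that does not share the block of the index 0.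
    Peel off that block and recurse. *)
Lemma reshape_index_inj (n : nat) (a b : seq nat) :
  is_composition n a -> is_composition n b ->
  (forall i j, i < n -> j < n -> (reshape_index a j < reshape_index a i) =
                                 (reshape_index b j < reshape_index b i)) ->
  a = b.
Proof.
move=> /andP[/eqP sum_a a_pos] /andP[/eqP sum_b b_pos].
elim: a b n sum_a sum_b a_pos b_pos => [|x a IHa] [|y b] n.
- by [].
- by move=> /= <- sum_b _ /andP[y_pos _]; lia.
- by move=> <- /= sum_a /andP[x_pos _]; lia.
move=> /= sum_a sum_b /andP[x_pos a_pos] /andP[y_pos b_pos] eq_ab.
have heads : x = y.
  have n_gt0 : 0 < n by rewrite -sum_a addn_gt0 x_pos.
  have [lt_xy|lt_yx|//] := ltngtP x y.
    have lt_xn : x < n by rewrite -sum_b ltn_addr.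
    have := eq_ab x 0 lt_xn n_gt0.
    by rewrite !reshape_index_cons ltnn x_pos lt_xy y_pos.
  have lt_yn : y < n by rewrite -sum_a ltn_addr.
  have := eq_ab y 0 lt_yn n_gt0.
  by rewrite !reshape_index_cons ltnn x_pos lt_yx y_pos.
subst y; congr (_ :: _); apply: (IHa b (sumn a)) => //.
  by lia.
move=> i j lti ltj; have := eq_ab (x + i) (x + j).
rewrite !reshape_index_cons !ltnNge !leq_addr /= !addKn ltnS -!ltnNge.
by rewrite -sum_a !ltn_add2l; apply.
Qed.

(** * Orders of block triangular groups *)

Section Matrices.
Variable F : finFieldType.
Local Open Scope ring_scope.

(** The block triangular group as a set of matrices of size m, instead of
    m.-1.+1, so that the sizes x + m of block matrices fit. *)
Definition block_unitmx (m : nat) (a : seq nat) : {set 'M[F]_m} :=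
  [set A | (A \in unitmx) && [forall i : 'I_m, forall j : 'I_m,
     (reshape_index a j < reshape_index a i)%N ==> (A i j == 0)]].

Lemma block_unitmxP (m : nat) (a : seq nat) (A : 'M[F]_m) :
  reflect (A \in unitmx /\ forall i j : 'I_m,
             (reshape_index a j < reshape_index a i)%N -> A i j = 0)
          (A \in block_unitmx m a).
Proof.
rewrite inE; apply: (iffP andP) => -[uA hA]; split=> //.
  move=> i j ltji; apply/eqP.
  by move/forallP/(_ i)/forallP/(_ j)/implyP: hA; apply.
by apply/forallP=> i; apply/forallP=> j; apply/implyP=> ltji; rewrite hA.
Qed.

Lemma mem_block_unitmx_cons (x m : nat) (s : seq nat)
    (A : 'M[F]_x) (B : 'M[F]_(x, m)) (C : 'M[F]_(m, x)) (D : 'M[F]_m) :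
  (block_mx A B C D \in block_unitmx (x + m) (x :: s)) =
  [&& A \in unitmx, C == 0 & D \in block_unitmx m s].
Proof.
have unit0 : (block_mx A B 0 D \in unitmx) = (A \in unitmx) && (D \in unitmx).
  by rewrite !unitmxE det_ublock GRing.unitrM.
have lidx i : reshape_index (x :: s) (lshift m i : 'I_(x + m)) = 0%N.
  by rewrite reshape_index_cons /= ltn_ord.
have ridx i :
    reshape_index (x :: s) (rshift x i : 'I_(x + m)) = (reshape_index s i).+1.
  by rewrite reshape_index_cons /= ltnNge leq_addr /= addKn.
apply/block_unitmxP/and3P=> [[uM hM]|[uA /eqP C0 /block_unitmxP[uD hD]]].
  have C0 : C = 0.
    apply/matrixP=> i j; have := hM (rshift x i) (lshift m j).
    by rewrite lidx ridx block_mxEdl mxE => ->.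
  move: uM; rewrite C0 unit0 => /andP[uA uD]; split=> //.
  apply/block_unitmxP; split=> // i j ltji.
  by have := hM (rshift x i) (rshift x j); rewrite !ridx block_mxEdr; apply.
subst C; split=> [|i j]; first by rewrite unit0 uA.
case: (split_ordP i) => i' ->; case: (split_ordP j) => j' ->.
- by rewrite !lidx.
- by rewrite lidx.
- by rewrite block_mxEdl mxE.
- by rewrite !ridx block_mxEdr ltnS; apply: hD.
Qed.

(** Such a matrix is block_mx A B 0 D with A invertible, B arbitrary and D of
    the same kind for the remaining blocks. *)
Lemma card_block_unitmx_cons (x m : nat) (s : seq nat) :
  #|block_unitmx (x + m) (x :: s)| =
  (#|[set A : 'M[F]_x | A \in unitmx]| * #|F| ^ (x * m) *
     #|block_unitmx m s|)%N.
Proof.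
pose f (t : ('M[F]_x * 'M[F]_(x, m)) * 'M[F]_m) : 'M[F]_(x + m) :=
  block_mx t.1.1 t.1.2 0 t.2.
have f_inj : injective f.
  by move=> [[A B] D] [[A' B'] D'] /eq_block_mx[/= -> -> _ ->].
rewrite -card_mx -cardsT -!cardsX -(card_imset _ f_inj).
apply: eq_card => M; rewrite -[M]submxK mem_block_unitmx_cons.
apply/and3P/imsetP=> [[uA /eqP C0 uD]|[[[A B] D]]].
  exists ((ulsubmx M, ursubmx M), drsubmx M); last by rewrite /f /= C0.
  by rewrite !in_setX uD !inE uA.
rewrite !inE /= andbT => /andP[uA uD] /eq_block_mx[-> _ -> ->]; split=> //.
Qed.

Lemma GLval_inj (n : nat) : injective (@GLval n F).
Proof. exact: val_inj. Qed.

Lemma GLval_unitmx (n : nat) (g : {'GL_n[F]}) : GLval g \in unitmx.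
Proof. exact: (@GL_unit n F g). Qed.

Lemma card_unitmx (x : nat) : (0 < x)%N ->
  #|[set A : 'M[F]_x | A \in unitmx]| = #|'GL_x[F]%g|.
Proof.
case: x => // x _; rewrite -[RHS](card_imset _ (@GLval_inj x.+1)).
apply: eq_card => A.
apply/idP/imsetP=> [|[g _ ->]]; rewrite inE; last exact: (@GLval_unitmx x.+1 g).
move=> uA.
by exists (FinRing.unit _ uA); rewrite ?inE.
Qed.

Lemma card_block_upper (n : nat) (a : seq nat) : (0 < n)%N ->
  #|block_upper n F a| = #|block_unitmx n a|.
Proof.
case: n => // n _; rewrite -[LHS](card_imset _ (@GLval_inj n.+1)).
apply: eq_card => A.
apply/imsetP/idP=> [[g] | ].
  by rewrite !inE => hg ->; rewrite (@GLval_unitmx n.+1 g).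
rewrite inE => /andP[uA hA].
by exists (FinRing.unit _ uA); rewrite ?inE.
Qed.

Lemma card_GL_qint (x : nat) : (0 < x)%N ->
  #|'GL_x[F]%g| =
    (#|F| ^ 'C(x, 2) *
       ((#|F| - 1) ^ x * \prod_(1 <= i < x.+1) qint #|F| i))%N.
Proof.
move=> x_gt0; rewrite card_GL //; congr (_ * _)%N.
under eq_bigr => i _ do rewrite subn1 predn_exp -subn1 -/(qint _ i).
by rewrite big_split /= prod_nat_const_nat subSS subn0.
Qed.

End Matrices.

Lemma logn_prod_gt0 (l : nat) (r : seq nat) (g : nat -> nat) :
  (forall i, i \in r -> 0 < g i) ->
  logn l (\prod_(i <- r) g i) = \sum_(i <- r) logn l (g i).
Proof.
elim: r => [|x r IHr] g_gt0; first by rewrite !big_nil logn1.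
have g_gt0_r i : i \in r -> 0 < g i.
  by move=> ri; rewrite g_gt0 // in_cons ri orbT.
rewrite !big_cons lognM ?IHr // ?g_gt0 ?mem_head //.
by rewrite big_seq prodn_cond_gt0.
Qed.

Section Theta.
Variables (q l e d : nat) (F : finFieldType).
Hypotheses (hq : #|F| = q) (l_pr : prime l) (he : is_min_index q l e).
Hypothesis hd : d = logn l (geom_quot q e).

Lemma card_field_gt1 : 1 < q.
Proof.
by rewrite -hq (cardD1 0%R) (cardD1 1%R) !inE GRing.oner_neq0.
Qed.

(** The valuation of [1] [2] ... [x], by sum_logn_qint. *)
Definition qfact_val (x : nat) : nat := d * (x %/ e) + logn l (x %/ e)`!.

Lemma logn_card_GL (x : nat) : 0 < x ->
  logn l #|'GL_x[F]%g| = x * logn l (q - 1) + qfact_val x.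
Proof.
move=> x_gt0; have q_gt1 := card_field_gt1; have q_gt0 := ltnW q_gt1.
have l_q k : logn l (q ^ k) = 0.
  by rewrite logn_coprime // coprimeXr // (@min_index_coprime q l e).
have qi_gt0 : 0 < \prod_(1 <= i < x.+1) qint q i.
  by rewrite big_nat prodn_cond_gt0 // => i /andP[i_gt0 _]; apply: qint_gt0.
rewrite card_GL_qint // hq lognM ?expn_gt0 ?q_gt0 //; last first.
  by rewrite muln_gt0 expn_gt0 subn_gt0 q_gt1.
rewrite l_q add0n lognM ?expn_gt0 ?subn_gt0 ?q_gt1 // lognX; congr (_ + _).
rewrite logn_prod_gt0 => [|i]; last first.
  by rewrite mem_index_iota => /andP[/qint_gt0].
by rewrite (@sum_logn_qint q l e) // -hd.
Qed.

Lemma block_unitmx_gt0 (m : nat) (a : seq nat) : 0 < #|block_unitmx F m a|.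
Proof.
apply/card_gt0P; exists (1%:M)%R; apply/block_unitmxP; split.
  exact: unitmx1.
by move=> i j ltji; rewrite mxE; case: eqP ltji => // ->; rewrite ltnn.
Qed.

Lemma logn_block_unitmx (a : seq nat) : all (leq 1) a ->
  logn l #|block_unitmx F (sumn a) a| =
    sumn a * logn l (q - 1) + \sum_(x <- a) qfact_val x.
Proof.
have q_gt1 := card_field_gt1; have q_gt0 := ltnW q_gt1.
elim: a => [|x a IHa] /=.
  move=> _; rewrite big_nil; apply: logn_coprime.
  suff -> : #|block_unitmx F 0 [::]| = 1 by rewrite coprimen1.
  apply/eqP; rewrite eqn_leq block_unitmx_gt0 andbT.
  by rewrite (leq_trans (max_card _)) // card_mx.
move=> /andP[x_gt0 a_pos]; rewrite card_block_unitmx_cons card_unitmx // hq.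
rewrite !lognM ?muln_gt0 ?expn_gt0 ?q_gt0 ?block_unitmx_gt0 ?cardG_gt0 //.
rewrite logn_card_GL // IHa // big_cons.
rewrite [logn l (q ^ _)]logn_coprime; last first.
  by rewrite coprimeXr // (@min_index_coprime q l e).
by lia.
Qed.

Lemma theta_block_upper (n : nat) (a : seq nat) : 0 < n -> is_composition n a ->
  theta l (block_upper_group n F a) +
    (n * logn l (q - 1) + \sum_(x <- a) qfact_val x) =
  logn l #|'GL_n[F]%g|.
Proof.
move=> n_gt0 /andP[/eqP sum_a a_pos].
rewrite -(Lagrange (subsetT (block_upper_group n F a))) lognM ?cardG_gt0 //.
rewrite addnC /theta; congr (_ + _).
by rewrite /= card_block_upper // -sum_a logn_block_unitmx.
Qed.

Lemma borel_sub_block_upper (n : nat) (a : seq nat) :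
  block_upper_group n F a \in standard_parabolics n F.
Proof.
rewrite inE; apply/subsetP=> g; rewrite !inE => /forallP hg.
apply/forallP=> i; apply/forallP=> j; apply/implyP=> ltji.
have /forallP/(_ j)/implyP := hg i; apply.
rewrite ltnNge; apply: contraL ltji => leij.
by rewrite -leqNgt leq_reshape_index.
Qed.

(** The transvection 1 + E_ij belongs to the block triangular group exactly
    when the block of j does not precede that of i, so the group knows the order
    relation between blocks. *)
Lemma block_upper_inj (n : nat) (a b : seq nat) : 0 < n ->
  is_composition n a -> is_composition n b ->
  block_upper_group n F a = block_upper_group n F b -> a = b.
Proof.
case: n => // n _ ca cb eq_ab.
apply: (reshape_index_inj ca cb) => i0 j0 lti ltj.
pose i := Ordinal lti; pose j := Ordinal ltj.
rewrite -[i0]/(i : nat) -[j0]/(j : nat).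
have [->|neq_ij] := eqVneq i j; first by rewrite !ltnn.
pose T : 'M[F]_n.+1 := (1%:M + delta_mx i j)%R.
have uT : T \in unitmx.
  have TT : (T *m (1%:M - delta_mx i j) = 1%:M)%R.
    rewrite /T mulmxDl mul1mx mulmxBr mulmx1 mul_delta_mx_0 1?eq_sym //.
    by rewrite GRing.subr0 GRing.subrK.
  by case: (mulmx1_unit TT).
have memT c : (FinRing.unit _ uT \in block_upper n.+1 F c) =
              ~~ (reshape_index c j < reshape_index c i).
  rewrite inE; apply/forallP/idP=> [hT|nlt k].
    have /forallP/(_ j)/implyP := hT i; rewrite /= !mxE !eqxx (negPf neq_ij) /=.
    by rewrite GRing.add0r GRing.oner_eq0 => hc; apply/negP=> /hc.
  apply/forallP=> m; apply/implyP=> lt_mk; rewrite /= !mxE.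
  have [eq_km|_] := eqVneq k m; first by rewrite eq_km ltnn in lt_mk.
  have [eq_ki|_] := eqVneq k i; last by rewrite GRing.addr0.
  have [eq_mj|_] := eqVneq m j; last by rewrite GRing.addr0.
  by rewrite eq_ki eq_mj (negPf nlt) in lt_mk.
by apply: negb_inj; rewrite -!memT; have /(congr1 val) /= -> := eq_ab.
Qed.

End Theta.

(** * Compositions with parts 1, e, e l and e l ^ 2 *)

Lemma sum_count_mem (T : eqType) (s r : seq T) (f : T -> nat) :
  uniq r -> {subset s <= r} ->
  \sum_(x <- s) f x = \sum_(y <- r) count_mem y s * f y.
Proof.
move=> r_uniq; elim: s => [|x s IHs] sub_sr.
  by rewrite big_nil big1.
rewrite big_cons IHs => [|y sy]; last by rewrite sub_sr // in_cons sy orbT.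
have rx : x \in r by rewrite sub_sr ?mem_head.
rewrite [LHS]addnC (bigD1_seq x) //= [RHS](bigD1_seq x) //= eqxx mulnDl mul1n.
rewrite -[RHS]addnA [RHS]addnC; congr (_ + _ + _).
by apply: eq_bigr => y /negPf neq_yx; rewrite eq_sym neq_yx.
Qed.

Section Parts.
Variables (n e l : nat).
Hypotheses (e_gt1 : 1 < e) (l_pr : prime l).

(** The composition with multiplicities m0, m1, m2 of e, e l, e l ^ 2,
    completed to n by parts equal to 1. *)
Definition pstar_parts (m0 m1 m2 : nat) : seq nat :=
  sort leq (nseq (n - e * psize l m0 m1 m2) 1 ++
            nseq m0 e ++ nseq m1 (e * l) ++ nseq m2 (e * l ^ 2)).

Lemma sum_pstar_parts (f : nat -> nat) (m0 m1 m2 : nat) :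
  \sum_(x <- pstar_parts m0 m1 m2) f x =
    (n - e * psize l m0 m1 m2) * f 1 +
    (m0 * f e + (m1 * f (e * l) + m2 * f (e * l ^ 2))).
Proof.
rewrite (perm_big _ (permEl (perm_sort _ _))) !big_cat !big_nseq /=.
by rewrite !iter_addn_0 !(mulnC (f _)).
Qed.

Lemma le_psize (m0 m1 m2 : nat) :
  (psize l m0 m1 m2 <= n %/ e) = (e * psize l m0 m1 m2 <= n).
Proof. by rewrite leq_divRL ?(ltnW e_gt1) // mulnC. Qed.

Lemma pstar_parts_composition (m0 m1 m2 : nat) :
  psize l m0 m1 m2 <= n %/ e -> is_composition n (pstar_parts m0 m1 m2).
Proof.
rewrite le_psize => le_n; apply/andP; split.
  rewrite sumnE sum_pstar_parts muln1; move: le_n.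
  rewrite /psize; set b := l ^ 2.
  by move=> le_n; apply/eqP; nia.
have l_gt0 := prime_gt0 l_pr; have e_gt0 := ltnW e_gt1.
by rewrite all_sort !all_cat !all_nseq !muln_gt0 l_gt0 e_gt0 !orbT.
Qed.

Lemma part_sizes_uniq : uniq [:: 1; e; e * l; e * l ^ 2].
Proof.
have l_gt1 := prime_gt1 l_pr; have e_gt0 := ltnW e_gt1.
have lt1 : e < e * l by rewrite -[X in X < _]muln1 ltn_pmul2l.
have lt2 : e * l < e * l ^ 2 by rewrite ltn_pmul2l // -mulnn ltn_Pmull // ltnW.
by rewrite /= !inE; lia.
Qed.

Lemma count_pstar_parts (m0 m1 m2 : nat) :
  [/\ count_mem 1 (pstar_parts m0 m1 m2) = n - e * psize l m0 m1 m2,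
      count_mem e (pstar_parts m0 m1 m2) = m0,
      count_mem (e * l) (pstar_parts m0 m1 m2) = m1
    & count_mem (e * l ^ 2) (pstar_parts m0 m1 m2) = m2].
Proof.
have := part_sizes_uniq.
rewrite /pstar_parts !count_sort !count_cat !count_nseq /=.
set b := e * l; set c := e * l ^ 2; rewrite !inE !negb_or !eqxx.
move=> /and4P[/and3P[/negPf n1e /negPf n1b /negPf n1c]].
move=> /andP[/negPf neb /negPf nec] /negPf nbc _.
rewrite !(eq_sym _ 1) ![_ == e](eq_sym _ e) ![c == b]eq_sym.
rewrite ?eqxx ?(n1e, n1b, n1c, neb, nec, nbc).
by rewrite [e == 1]eq_sym n1e /= !mul0n !mul1n !addn0 !add0n.
Qed.

Lemma pstar_parts_inj (m0 m1 m2 k0 k1 k2 : nat) :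
  pstar_parts m0 m1 m2 = pstar_parts k0 k1 k2 ->
  [/\ m0 = k0, m1 = k1 & m2 = k2].
Proof.
move=> eq_mk.
have [_ m0E m1E m2E] := count_pstar_parts m0 m1 m2.
have [_ k0E k1E k2E] := count_pstar_parts k0 k1 k2.
by move: m0E m1E m2E; rewrite eq_mk k0E k1E k2E.
Qed.

Lemma mem_pstar_parts (m0 m1 m2 : nat) :
  {subset pstar_parts m0 m1 m2 <= [:: 1; e; e * l; e * l ^ 2]}.
Proof.
move=> x; rewrite mem_sort !mem_cat !mem_nseq !inE.
by case/or4P=> /andP[_ ->]; rewrite ?orbT.
Qed.

Lemma pstar_parts_part (m0 m1 m2 x : nat) : x \in pstar_parts m0 m1 m2 ->
  x = 1 \/ exists i, x = e * l ^ i.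
Proof.
move=> /mem_pstar_parts; rewrite !inE => /or4P[] /eqP->; first by left.
- by right; exists 0; rewrite muln1.
- by right; exists 1; rewrite expn1.
- by right; exists 2.
Qed.

(** A part e l ^ i is at most n, so l ^ i <= n / e < l ^ 3. The multiplicities
    of the three possible parts other than 1 determine that of 1 since the
    parts add up to n, and a sorted sequence is determined by its
    multiplicities. *)
Lemma pstar_partsP (a : seq nat) : n %/ e < l ^ 3 ->
  is_composition n a -> sorted leq a ->
  (forall x, x \in a -> x = 1 \/ exists i, x = e * l ^ i) ->
  exists m0 m1 m2, psize l m0 m1 m2 <= n %/ e /\ a = pstar_parts m0 m1 m2.
Proof.
move=> lt_n3 /andP[/eqP sum_a _] a_sorted parts.
pose r := [:: 1; e; e * l; e * l ^ 2].
have sub_ar : {subset a <= r}.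
  move=> x ax; case: (parts x ax) => [->|[i def_x]]; first exact: mem_head.
  have le_xn : x <= n.
    rewrite -sum_a sumnE (big_rem x) //=; exact: leq_addr.
  have lt_i3 : i < 3.
    rewrite -(ltn_exp2l _ _ (prime_gt1 l_pr)) (leq_ltn_trans _ lt_n3) //.
    by rewrite leq_divRL ?(ltnW e_gt1) // mulnC -def_x.
  by rewrite def_x !inE; case: i lt_i3 {def_x} => [|[|[|]]] // _;
     rewrite ?muln1 ?expn1 eqxx ?orbT.
have sum_n := sum_count_mem id part_sizes_uniq sub_ar.
rewrite -sumnE sum_a !big_cons big_nil addn0 muln1 in sum_n.
exists (count_mem e a), (count_mem (e * l) a), (count_mem (e * l ^ 2) a).
have sum_e : n = count_mem 1 a +
    e * psize l (count_mem e a) (count_mem (e * l) a) (count_mem (e * l ^ 2) a).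
  by rewrite {1}sum_n /psize; set b := l ^ 2; lia.
split; first by rewrite le_psize [leqRHS]sum_e leq_addl.
apply: (sorted_eq leq_trans anti_leq) => //.
  exact: (sort_sorted leq_total).
have [c1 c0 cl cl2] := count_pstar_parts (count_mem e a) (count_mem (e * l) a)
  (count_mem (e * l ^ 2) a).
apply/allP=> x; rewrite mem_cat => ax.
have : x \in r.
  by case/orP: ax => [/sub_ar //|/mem_pstar_parts].
rewrite !inE => /or4P[] /eqP-> /=; rewrite ?c0 ?cl ?cl2 ?c1 //.
by rewrite [X in _ == X - _]sum_e addnK.
Qed.
End Parts.

(** * Injectivity of theta *)

Section Main.
Variables (n q l e d : nat) (F : finFieldType).
Hypotheses (n_gt0 : 0 < n) (hq : #|F| = q) (l_pr : prime l).
Hypotheses (he : is_min_index q l e) (hd : d = logn l (geom_quot q e)).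

Lemma sum_qfact_val_pstar_parts (m0 m1 m2 : nat) :
  \sum_(x <- pstar_parts n e l m0 m1 m2) qfact_val l e d x =
    pweight l d m0 m1 m2.
Proof.
have e_gt1 : 1 < e by case: he.
have val_mul k : qfact_val l e d (e * k) = d * k + logn l k`!.
  by rewrite /qfact_val mulKn // ltnW.
have val1 : qfact_val l e d 1 = 0.
  by rewrite /qfact_val divn_small // fact0 logn1 muln0.
have fact_l k : logn l (l * k)`! = k + logn l k`! by apply: logn_fact_mul.
have fact_1 : logn l l`! = 1 by rewrite -{2}[l]muln1 fact_l logn1.
have val_e : qfact_val l e d e = d.
  by rewrite -{2}[e]muln1 val_mul muln1 logn1 addn0.
rewrite sum_pstar_parts val1 val_e !val_mul fact_1 -mulnn fact_l fact_1.
by rewrite muln0 add0n /pweight /psize -mulnn; lia.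
Qed.

Lemma theta_pstar_parts (m0 m1 m2 : nat) :
  psize l m0 m1 m2 <= n %/ e ->
  theta l (block_upper_group n F (pstar_parts n e l m0 m1 m2)) +
    (n * logn l (q - 1) + pweight l d m0 m1 m2) = logn l #|'GL_n[F]%g|.
Proof.
have e_gt1 : 1 < e by case: he.
move=> le_m; rewrite -sum_qfact_val_pstar_parts.
apply: theta_block_upper => //; exact: pstar_parts_composition.
Qed.

(** Whatever the value of n / e, a collision of weights is realised by two
    compositions whose parts are at most e l ^ 2. *)
Lemma pweight_injective_of_theta :
  theta_injective n F e l -> pweight_injective l d (n %/ e).
Proof.
have e_gt1 : 1 < e by case: he.
move=> inj m0 m1 m2 k0 k1 k2 le_m le_k eq_w.
pose P m0 m1 m2 := block_upper_group n F (pstar_parts n e l m0 m1 m2).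
have memP x0 x1 x2 : psize l x0 x1 x2 <= n %/ e -> in_Pstar e l (P x0 x1 x2).
  move=> le_x; split; first exact: borel_sub_block_upper.
  exists (pstar_parts n e l x0 x1 x2); split=> //.
  - exact: pstar_parts_composition.
  - exact: (sort_sorted leq_total).
  - by move=> x; apply: pstar_parts_part.
suff eq_parts : pstar_parts n e l m0 m1 m2 = pstar_parts n e l k0 k1 k2.
  exact: (pstar_parts_inj e_gt1 l_pr eq_parts).
apply: (@block_upper_inj F n) => //; try exact: pstar_parts_composition.
apply: inj; try exact: memP.
apply: (@addIn (n * logn l (q - 1) + pweight l d m0 m1 m2)).
by rewrite {2}eq_w !theta_pstar_parts.
Qed.

Lemma theta_injective_of_pweight : n %/ e < l ^ 3 ->
  pweight_injective l d (n %/ e) -> theta_injective n F e l.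
Proof.
have e_gt1 : 1 < e by case: he.
move=> lt_n3 inj P Q [_ [a [a_comp defP a_sorted a_parts]]]
  [_ [b [b_comp defQ b_sorted b_parts]]].
have [m0 [m1 [m2 [le_m def_a]]]] :=
  pstar_partsP e_gt1 l_pr lt_n3 a_comp a_sorted a_parts.
have [k0 [k1 [k2 [le_k def_b]]]] :=
  pstar_partsP e_gt1 l_pr lt_n3 b_comp b_sorted b_parts.
rewrite defP defQ def_a def_b => eq_theta.
suff [-> -> ->] : [/\ m0 = k0, m1 = k1 & m2 = k2] by [].
apply: inj => //; apply: (@addnI (n * logn l (q - 1))).
apply: (@addnI (theta l (block_upper_group n F (pstar_parts n e l m0 m1 m2)))).
by rewrite {2}eq_theta !theta_pstar_parts.
Qed.
End Main.

Theorem lemma12p4 (n p q l e d : nat) (F : finFieldType)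
    (hn : 2 <= n) (hq : #|F| = q) (hp : p \in [pchar F]%R)
    (hl : prime l) (hlp : l != p)
    (he : is_min_index q l e) (hd : d = logn l (geom_quot q e)) :
  [/\ d <= l -> (theta_injective n F e l <-> n %/ e <= d * l),
      d = l.+1 -> (theta_injective n F e l <-> n %/ e <= l ^ 2)
    & l.+1 < d -> (theta_injective n F e l <-> n %/ e < l ^ 2 + l)].
Proof.
have n_gt0 := ltnW hn; have l_gt1 := prime_gt1 hl.
have d_gt0 : 0 < d.
  rewrite hd logn_gt0 mem_primes hl.
  have q_gt1 := card_field_gt1 hq; case: he => e_gt1 -> _.
  by rewrite geom_quotE // qint_gt0 // ltnW.
have le_cube : l ^ 2 + l <= l ^ 3.
  by rewrite (expnS l 2); have := mulnn l; move: (l ^ 2) => b; nia.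
have lt_sq : l ^ 2 < l ^ 3 by rewrite ltn_exp2l.
have inj_iff (B : Prop) : (B -> n %/ e < l ^ 3) ->
    (pweight_injective l d (n %/ e) <-> B) -> (theta_injective n F e l <-> B).
  move=> ltB [toB ofB]; split=> [inj|b].
    by apply: toB; apply: (pweight_injective_of_theta n_gt0 hq hl he hd).
  apply: (theta_injective_of_pweight n_gt0 hq hl he hd).
    exact: ltB.
  exact: ofB.
have [small mid large] := pweight_injective_iff (n %/ e) l_gt1 d_gt0.
split=> hdl; (apply: inj_iff; last by auto) => le_n.
- apply: leq_ltn_trans le_n (leq_ltn_trans _ lt_sq).
  by rewrite -mulnn leq_mul2r hdl orbT.
- exact: leq_ltn_trans le_n lt_sq.
- exact: leq_trans le_n le_cube.
Qed.
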